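(* Let $n\in\mathbb{N}$. Then: (i) $\kappa(\mathrm{Alt}(n))\geq 2$ for all $n\geq 3$. (ii) $\kappa(\mathrm{Sym}(n))\geq 2$ for all $n\geq 2$ with $n\neq 6$, while $\kappa(\mathrm{Sym}(6))=0$.
   Context: $\mathrm{Sym}(n)$ and $\mathrm{Alt}(n)$ denote the symmetric and alternating groups on $\{1,\dots,n\}$. For a finite group $G$, a set $X$ of conjugacy classes of $G$ is called independent if any pair of elements from distinct classes in $X$ generates $G$ (that is, for all distinct $C,D\in X$ and all $g\in C$, $h\in D$, one has $\langle g,h\rangle=G$). $\kappa(G)$ is the maximum size (possibly zero) of an independent set of conjugacy classes of $G$. Convention: only sets containing at least two classes are considered, and $\kappa(G)=0$ if there is no independent set with at least two classes. *)

(* Defs.v *)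
From mathcomp Require Import all_boot all_fingroup all_solvable.

Set Implicit Arguments.
Unset Strict Implicit.
Unset Printing Implicit Defensive.

Import GroupScope.

Definition independent (gT : finGroupType) (G : {group gT})
    (X : {set {set gT}}) : bool :=
  (X \subset classes G) &&
  [forall C in X, forall D in X, (C != D) ==>
    [forall g in C, forall h in D, <<[set g; h]>> == G]].

(* The empty maximum is 0, so kappa G = 0 when no independent set has at least
   two classes. *)
Definition kappa (gT : finGroupType) (G : {group gT}) : nat :=
  \max_(X : {set {set gT}} | independent G X && (1 < #|X|)) #|X|.

(* Main.v *)
Require Import Defs.
From mathcomp Require Import all_boot all_fingroup all_solvable.
From mathcomp Require Import zify.

(* Each lower bound comes from two cycle types C and D such that every pair of
   representatives generates.  D is chosen so that some power of its elements
   is a transposition or a 3-cycle.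
   - If C = (n-1, 1) and D has no fixed point, the generated group is
     2-transitive, and a 2-transitive group containing a transposition
     (a 3-cycle) contains Sym(n) (Alt(n)).  For Sym(n) take D = (n-2, 2) or
     (n-5, 3, 2) according to the parity of n; for Alt(n) with n even take
     D = (n-3, 3), or (n-7, 3, 2, 2) if 3 divides n.
   - For Alt(n) with n odd, C = (n).  Points moved by a common 3-cycle of the
     generated group form the blocks of an invariant partition, so the block
     size divides n; with D = (3, m, m), or (3, 1, n-4) if 3 divides n, the
     cycles of D force a block with more than n/2 points.
   In Sym(6) any two cycle types occur together in Alt(6), Sym(5), the
   transitive PGL(2,5), Sym(4) x Sym(2) or Sym(3) wr Sym(2). *)

Set Implicit Arguments.
Unset Strict Implicit.
Unset Printing Implicit Defensive.

Import GroupScope.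

(** * Cycle types *)

Section CycleType.

Variable T : finType.
Implicit Types (s t u : {perm T}) (c : seq T) (cs : seq (seq T)).

(* The lists need not cover [T]: where it matters, the sum of their lengths is
   assumed to be [#|T|], so that fixed points are listed as cycles of length 1. *)
Definition cycle_decomp s cs := uniq (flatten cs) && all (fcycle s) cs.

Definition has_type (ks : seq nat) s :=
  exists2 cs, cycle_decomp s cs & map size cs = ks.

Lemma cycle_decompJ s u cs :
  cycle_decomp s cs -> cycle_decomp (s ^ u) (map (map u) cs).
Proof.
case/andP=> cs_uniq /allP cs_cyc; apply/andP; split.
  by rewrite -map_flatten map_inj_uniq //; apply: perm_inj.
apply/allP=> _ /mapP[c /cs_cyc c_cyc ->].
apply: homo_cycle c_cyc => x y /= /eqP <-.
by rewrite permJ.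
Qed.

Lemma has_typeJ ks s u : has_type ks s -> has_type ks (s ^ u).
Proof.
case=> cs /(cycle_decompJ u) cs_u <-; exists (map (map u) cs) => //.
by rewrite -map_comp; apply: eq_map => c; rewrite /= size_map.
Qed.

(** Products of permutations act from left to right, so for distinct entries this product of
    transpositions sends each entry to the next and the last to the first. The form also displays
    the parity. *)
Definition cyc c : {perm T} :=
  if c is x :: c' then \prod_(y <- c') tperm x y else 1.

Lemma cyc_cons x y c : cyc (x :: y :: c) = tperm x y * cyc (x :: c).
Proof. by rewrite /= big_cons. Qed.

Lemma cyc_out c x : x \notin c -> cyc c x = x.
Proof.
case: c => [|y c] /=; first by rewrite perm1.
elim: c => [|z c IHc]; rewrite ?big_nil ?perm1 // !inE !negb_or big_cons.
case/and3P=> xy xz xc; rewrite permM tpermD 1?eq_sym //.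
by rewrite IHc // inE negb_or xy.
Qed.

(** Induction on the tail: multiplying by [tperm x y] on the left inserts [y] between [x] and its
    image under [cyc (x :: c)]. *)
Lemma cyc_fcycle c : uniq c -> fcycle (cyc c) c.
Proof.
case: c => // x c; elim: c => [|y c IHc].
  by rewrite /= big_nil perm1 eqxx.
move=> /[dup] xyc_uniq /=; rewrite inE negb_or.
case/andP=> /andP[xy xc] /andP[yc c_uniq].
set h := \prod_(z <- _) _; have Dh: h = tperm x y * cyc (x :: c).
  exact: cyc_cons.
have hx : h x = y.
  by rewrite Dh permM tpermL cyc_out // inE negb_or eq_sym xy.
have hy : h y = cyc (x :: c) x by rewrite Dh permM tpermR.
have hz z : z \in c -> h z = cyc (x :: c) z.
  move=> zc; rewrite Dh permM tpermD //.
    by apply: contraNneq xc => ->.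
  by apply: contraNneq yc => ->.
rewrite hx eqxx /=.
have := IHc _; rewrite /cycle /= xc c_uniq => /(_ isT).
move: hy hz; rewrite -/(cyc (x :: c)); move: (cyc _) h {Dh hx} => h' h hy hz.
case: c hz {IHc xc yc c_uniq xyc_uniq} => [_|z c hz] /=; first by rewrite hy.
rewrite hy => /andP[-> /=]; rewrite !rcons_path /= hz ?mem_last // => /andP[hc ->].
rewrite andbT (eq_in_path (P := mem (z :: c)) (e' := frel h')) //; last exact/allP.
by move=> w w' wzc _; rewrite /= hz.
Qed.

Lemma odd_cyc c : uniq c -> odd_perm (cyc c) = odd (size c).-1.
Proof.
case: c => [|x c]; first by rewrite odd_perm1.
elim: c => [|y c IHc]; first by rewrite /= big_nil odd_perm1.
move=> /= /andP[]; rewrite inE negb_or => /andP[xy xc] /andP[_ c_uniq].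
by rewrite big_cons odd_mul_tperm xy IHc //= xc.
Qed.

(** The middle claim carries the induction: the product over the later lists fixes every entry of
    [c], so it does not disturb that cycle. *)
Lemma prod_cyc cs (s := \prod_(c <- cs) cyc c) : uniq (flatten cs) ->
  [/\ all (fcycle s) cs, {in [predC flatten cs], s =1 id}
    & odd_perm s = odd (sumn [seq (size c).-1 | c <- cs])].
Proof.
rewrite /s {s}; elim: cs => [|c cs IHcs].
  by rewrite big_nil odd_perm1; split=> // x _; rewrite perm1.
rewrite [flatten _]/= cat_uniq => /and3P[c_uniq c'cs /IHcs[cs_cyc cs_id odd_cs]].
rewrite big_cons; set s := \prod_(_ <- cs) _ in cs_cyc cs_id odd_cs *.
have s_c x : x \in c -> s x = x.
  by move=> xc; apply: cs_id; rewrite !inE; apply: contra c'cs => ?; apply/hasP; exists x.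
split; last by rewrite odd_permM odd_cs odd_cyc //= oddD.
  have allc d : all (mem d) d by apply/allP.
  apply/andP; split.
    rewrite (eq_in_cycle (P := mem c) (e' := frel (cyc c))) ?cyc_fcycle //.
    move=> x y xc _ /=; rewrite permM s_c //.
    by rewrite -(nextE (cyc_fcycle c_uniq)) ?mem_next.
  apply/allP=> d d_cs; have /(_ d d_cs) := allP cs_cyc.
  rewrite (eq_in_cycle (P := mem d) (e' := frel (cyc c * s))) // => x y xd _.
  rewrite /= permM cyc_out //; apply: contra c'cs => xc.
  by apply/hasP; exists x => //; apply/flattenP; exists d.
move=> x; rewrite !inE mem_cat negb_or => /andP[xc xcs].
by rewrite permM cyc_out // cs_id.
Qed.

Lemma has_type_exists ks : sumn ks = #|T| ->
  exists2 s, has_type ks s & odd_perm s = odd (sumn (map predn ks)).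
Proof.
(* The enumeration of [T] is cut into consecutive blocks of the prescribed lengths, and each block
   becomes a cycle. *)
move=> ksT; set cs := reshape ks (enum T).
have csK : flatten cs = enum T by rewrite reshapeKr // -cardE ksT.
have cs_ks : map size cs = ks by rewrite -[map _ _]/(shape cs) reshapeKl // -cardE ksT.
have [|cs_cyc _ odd_s] := @prod_cyc cs; first by rewrite csK enum_uniq.
exists (\prod_(c <- cs) cyc c); first by exists cs => //; rewrite /cycle_decomp csK enum_uniq.
by rewrite odd_s -cs_ks -map_comp.
Qed.

Lemma mem_uniq_flatten cs x : uniq (flatten cs) -> sumn (map size cs) = #|T| ->
  x \in flatten cs.
Proof.
move=> cs_uniq cs_size; have card_cs : #|flatten cs| = #|T|.
  by rewrite (card_uniqP cs_uniq) size_flatten.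
by rewrite ((subset_cardP card_cs) (subset_predT _)).
Qed.

Lemma has_type_decomp ks s : sumn ks = #|T| -> has_type ks s ->
  exists cs, [/\ map size cs = ks, uniq (flatten cs), {in cs, forall c, fcycle s c}
    & forall x, x \in flatten cs].
Proof.
move=> ksT [cs /andP[cs_uniq /allP cs_cyc] cs_ks]; exists cs; split=> // x.
by rewrite mem_uniq_flatten // cs_ks.
Qed.

(** Both decompositions list all points in the same shape, so matching the lists entry by entry
    gives a bijection that carries cycles to cycles. *)
Lemma has_type_conj ks s t : sumn ks = #|T| -> has_type ks s -> has_type ks t ->
  exists u, t = s ^ u.
Proof.
move=> ksT /(has_type_decomp ksT)[cs [cs_ks cs_uniq cs_cyc cs_all]].
case/(has_type_decomp ksT)=> ds [ds_ks ds_uniq ds_cyc ds_all].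
have cdE : size (flatten cs) = size (flatten ds).
  by rewrite !size_flatten /shape cs_ks ds_ks.
(* The default [x] is never returned, as both lists have the same length; taking the point itself
   avoids asking for an element of [T]. *)
pose f x := nth x (flatten ds) (index x (flatten cs)).
have f_inj : injective f.
  move=> x y; have [xcs ycs] := (cs_all x, cs_all y).
  rewrite /f (set_nth_default x y) -?cdE ?index_mem //.
  move/eqP; rewrite nth_uniq -?cdE ?index_mem // => /eqP ixy.
  by rewrite -(nth_index x xcs) ixy nth_index.
pose u := perm f_inj; exists u.
have ds_u : ds = map (map u) cs.
  apply: eq_from_flatten_shape; last first.
    rewrite /shape ds_ks -map_comp -cs_ks; apply: eq_map => c.
    by rewrite /= size_map.
  rewrite -map_flatten; case Ecs: (flatten cs) => [|x0 l] in cdE *.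
    by case: (flatten ds) cdE.
  rewrite -Ecs in cdE *; apply: (eq_from_nth (x0 := x0)); first by rewrite size_map.
  move=> i; rewrite -cdE => i_lt; rewrite (nth_map x0) // permE /f.
  by rewrite index_uniq //; apply: set_nth_default; rewrite -cdE.
apply/permP=> x; have /flattenP[c c_cs xc] := ds_all x.
have c_cyc : fcycle (s ^ u) c.
  have := cs_cyc; rewrite ds_u in c_cs; have [d d_cs ->] := mapP c_cs.
  move=> /(_ _ d_cs); apply: homo_cycle => y z /= /eqP <-.
  by rewrite permJ.
by rewrite -(nextE c_cyc xc) -(nextE (ds_cyc _ c_cs) xc).
Qed.

(** One orbit is listed for each root, and orbits with different roots are disjoint. *)
Lemma cycle_decomp_exists s :
  exists cs, [/\ cycle_decomp s cs, size (flatten cs) = #|T| & all (ltn 0) (map size cs)].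
Proof.
pose cs := [seq fingraph.orbit s x | x <- enum (froots s)].
have cs_all x : x \in flatten cs.
  apply/flatten_mapP; exists (froot s x).
    by rewrite mem_enum; apply/roots_root/fconnect_sym/perm_inj.
  by rewrite -fconnect_orbit fconnect_sym ?connect_root //; apply: perm_inj.
have cs_uniq : uniq (flatten cs).
  rewrite /cs; have : all [in froots s] (enum (froots s)).
    by apply/allP=> x; rewrite mem_enum.
  elim: (enum _) (enum_uniq (froots s)) => //= x r IHr /andP[xr r_uniq].
  case/andP=> x_root r_root; rewrite cat_uniq orbit_uniq IHr // andbT /=.
  apply/hasP=> -[y /flatten_mapP[x' x'r]]; rewrite -!fconnect_orbit => x'y xy.
  have sym_s := fconnect_sym (@perm_inj _ s).
  move: x'y xy (eqP (allP r_root x' x'r)) (eqP x_root).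
  rewrite -!(root_connect sym_s) => /eqP-> /eqP-> -> xx'.
  by move: xr; rewrite -xx' x'r.
exists cs; split.
- rewrite /cycle_decomp cs_uniq; apply/allP=> _ /mapP[x _ ->].
  exact/cycle_orbit/perm_inj.
- by rewrite -(card_uniqP cs_uniq); apply: eq_card => x; rewrite cs_all.
by apply/allP=> _ /mapP[_ /mapP[x _ ->] ->] /=; rewrite fingraph.size_orbit fingraph.order_gt0.
Qed.

Lemma uniq_flatten_mem c cs : uniq (flatten cs) -> c \in cs -> uniq c.
Proof.
move=> cs_uniq c_cs; move: cs_uniq.
by rewrite (perm_uniq (perm_flatten (perm_to_rem c_cs))) cat_uniq => /andP[].
Qed.

Lemma expg_size_cycle s c x : uniq c -> fcycle s c -> x \in c -> (s ^+ size c) x = x.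
Proof.
move=> c_uniq c_cyc xc.
by rewrite permX -(order_cycle c_cyc c_uniq xc) (iter_order_cycle c_cyc).
Qed.

Lemma expg_mod_cycle s c x k : uniq c -> fcycle s c -> x \in c ->
  (s ^+ k) x = (s ^+ (k %% size c)) x.
Proof.
move=> c_uniq c_cyc xc; rewrite [in LHS](divn_eq k (size c)) expgD permM mulnC expgM.
by congr ((_ : {perm T}) _); rewrite permX_fix // expg_size_cycle.
Qed.

(* The exponent is 1 modulo the length of [c] and 0 modulo [m]. *)
Lemma cycle_power s c cs m : sumn (map size (c :: cs)) = #|T| ->
    uniq (flatten (c :: cs)) -> {in c :: cs, forall d, fcycle s d} ->
    {in cs, forall d, size d %| m} -> coprime (size c) m ->
  exists k, {in c, s ^+ k =1 s} /\ {in [predC c], s ^+ k =1 id}.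
Proof.
move=> csT cs_uniq cs_cyc cs_m co_c_m.
have s_mod d x k : d \in c :: cs -> x \in d -> (s ^+ k) x = (s ^+ (k %% size d)) x.
  by move=> d_cs; apply: expg_mod_cycle; rewrite ?(uniq_flatten_mem cs_uniq) ?cs_cyc.
have [k k1 k0] : exists2 k, k = 1 %[mod size c] & m %| k.
  exists (chinese (size c) m 1 0); first exact: chinese_modl.
  by rewrite /dvdn chinese_modr // mod0n.
exists k; split=> x xc.
  by rewrite -[in RHS](expg1 s) (s_mod c x k) ?mem_head // k1 -(s_mod c) ?mem_head.
have := mem_uniq_flatten x cs_uniq csT; rewrite mem_cat (negPf xc) /=.
case/flattenP=> d d_cs xd; have d_ccs : d \in c :: cs by rewrite inE d_cs orbT.
rewrite (s_mod d) // (eqP (dvdn_trans (cs_m d d_cs) k0)).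
exact: perm1.
Qed.

End CycleType.

(** * Three-cycles *)

Section ThreeCycles.

Variable T : finType.
Implicit Types (s t u : {perm T}) (x y z w : T) (G : {group {perm T}}).

Definition cyc3 x y z : {perm T} := tperm x y * tperm x z.

Lemma cyc3J x y z s : cyc3 x y z ^ s = cyc3 (s x) (s y) (s z).
Proof. by rewrite conjMg !tpermJ. Qed.

Lemma cyc3V x y z : (cyc3 x y z)^-1 = cyc3 x z y.
Proof. by rewrite invMg !tpermV. Qed.

Lemma cyc3_val x y z : uniq [:: x; y; z] ->
  [/\ cyc3 x y z x = y, cyc3 x y z y = z & cyc3 x y z z = x].
Proof.
rewrite /= !inE negb_or andbT => /andP[/andP[xy xz] yz].
split; rewrite permM; first by rewrite tpermL tpermD // eq_sym.
  by rewrite tpermR tpermL.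
by rewrite (tpermD xz yz) tpermR.
Qed.

Lemma cyc3_out x y z w : w \notin [:: x; y; z] -> cyc3 x y z w = w.
Proof.
rewrite !inE !negb_or => /and3P[wx wy wz].
by rewrite permM !tpermD // eq_sym.
Qed.

(** Conjugating the cycle by itself leaves it unchanged but shifts its entries. *)
Lemma cyc3_rot x y z : uniq [:: x; y; z] -> cyc3 y z x = cyc3 x y z.
Proof.
case/cyc3_val=> sx sy sz; have := cyc3J x y z (cyc3 x y z).
by rewrite sx sy sz conjgE mulKg.
Qed.

(** This turns out to be an equivalence relation preserved by [G], whose classes serve as blocks. *)
Definition cyc3_linked G x y :=
  (x == y) || [exists z, uniq [:: x; y; z] && (cyc3 x y z \in G)].

Lemma cyc3_linkedP G x y : reflect
  (x = y \/ exists2 z, uniq [:: x; y; z] & cyc3 x y z \in G) (cyc3_linked G x y).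
Proof.
apply: (iffP orP) => -[/eqP|]; try by left.
  by case/existsP=> z /andP[]; right; exists z.
by case=> z xyz sG; right; apply/existsP; exists z; rewrite xyz.
Qed.

Lemma cyc3_linked_refl G : reflexive (cyc3_linked G).
Proof. by move=> x; rewrite /cyc3_linked eqxx. Qed.

Lemma uniq3C x y z : uniq [:: x; y; z] = uniq [:: y; x; z].
Proof. exact: perm_uniq (permEl (perm_catCA [:: x] [:: y] [:: z])). Qed.

Lemma cyc3_linked_sym G : symmetric (cyc3_linked G).
Proof.
suff imp x y : cyc3_linked G x y -> cyc3_linked G y x by move=> x y; apply/idP/idP; apply: imp.
case/cyc3_linkedP=> [->|[z xyz sG]]; apply/cyc3_linkedP; [by left | right].
rewrite uniq3C in xyz; exists z => //.
by rewrite -cyc3_rot // -cyc3V groupV.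
Qed.

Lemma cyc3_linkedJ G s x y : s \in G -> cyc3_linked G x y -> cyc3_linked G (s x) (s y).
Proof.
move=> sG /cyc3_linkedP[->|[z xyz zG]]; apply/cyc3_linkedP; [by left | right].
exists (s z); last by rewrite -cyc3J groupJ.
by rewrite -(map_inj_uniq (@perm_inj _ s)) in xyz.
Qed.

(* Conjugating one 3-cycle by another moves the link from [y] to [z]. *)
Lemma cyc3_linked_trans G : transitive (cyc3_linked G).
Proof.
move=> y x z /[dup] xy /cyc3_linkedP[-> //|[u xyu sG]].
case/cyc3_linkedP=> [<- //|[v yzv tG]].
have [-> | xz] := eqVneq x z; first exact: cyc3_linked_refl.
have [t_y t_z t_v] := cyc3_val yzv.
have [eq_vx | vx] := eqVneq v x.
  subst v; rewrite cyc3_linked_sym; apply/cyc3_linkedP; right.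
  have zxy : uniq [:: z; x; y] by rewrite -(rot_uniq 2).
  by exists y; last rewrite (cyc3_rot yzv).
apply/cyc3_linkedP; right.
have t_x : cyc3 y z v x = x.
  apply: cyc3_out; move: xyu; rewrite /= !inE !negb_or xz (eq_sym x v) vx.
  by case/andP=> /andP[->].
have := xyu; rewrite -(map_inj_uniq (@perm_inj _ (cyc3 y z v))) [map _ _]/= t_x t_y.
move=> xzu; exists (cyc3 y z v u) => //.
by have := cyc3J x y u (cyc3 y z v); rewrite t_x t_y => <-; apply: groupJ.
Qed.

Lemma cyc3M x y z w : cyc3 x y z * cyc3 x z w = cyc3 x y w.
Proof. by rewrite /cyc3 mulgA -(mulgA (tperm x y)) tperm2 mulg1. Qed.

(** Start from 3-cycles [cyc3 x y z] and [cyc3 z w v] in [G]. If [v] differs from [x] and [y],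
    conjugating the first by the second replaces [z] by [w]; otherwise [cyc3M] produces the wanted
    cycle as a product. *)
Lemma cyc3_linked_cyc3 G : (forall x y, cyc3_linked G x y) ->
  forall x y z, uniq [:: x; y; z] -> cyc3 x y z \in G.
Proof.
move=> linkG x y w xyw; have xy : x != y by move: xyw; rewrite /= !inE; case: (x == y).
have /cyc3_linkedP[/eqP | [z xyz sG]] := linkG x y; first by rewrite (negPf xy).
have [-> // | wz] := eqVneq w z.
have /cyc3_linkedP[/eqP | [v zwv tG]] := linkG z w; first by rewrite eq_sym (negPf wz).
have [eq_vx | vx] := eqVneq v x.
  subst v; have xzw : uniq [:: x; z; w] by rewrite -(rot_uniq 1).
  by rewrite -(cyc3M x y z w) groupM // -(cyc3_rot xzw).
have [eq_vy | vy] := eqVneq v y.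
  subst v; have yzw : uniq [:: y; z; w] by rewrite -(rot_uniq 1).
  rewrite -(cyc3_rot xyw) -(cyc3M y w z x) groupM // ?(cyc3_rot xyz) //.
  by rewrite -groupV cyc3V -(cyc3_rot yzw).
have [t_z _ _] := cyc3_val zwv.
have t_x : cyc3 z w v x = x.
  apply: cyc3_out; move: xyz xyw; rewrite /= !inE !negb_or !(eq_sym x).
  by case/andP=> /andP[_ ->] _ /andP[/andP[_ ->]]; rewrite vx.
have t_y : cyc3 z w v y = y.
  apply: cyc3_out; move: xyz xyw; rewrite /= !inE !negb_or !(eq_sym y).
  by case/and3P=> _ -> _ /and3P[_ -> _]; rewrite vy.
by have := cyc3J x y z (cyc3 z w v); rewrite t_x t_y t_z => <-; apply: groupJ.
Qed.

(** An even permutation is a product of pairs of transpositions, and each pair is a product of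
    3-cycles. *)
Lemma Alt_sub_of_cyc3 G : (forall x y z, uniq [:: x; y; z] -> cyc3 x y z \in G) ->
  'Alt_T \subset G.
Proof.
move=> cyc3G; have pairG x y z w : x != y -> z != w -> tperm x y * tperm z w \in G.
  have shareG a b c : a != b -> a != c -> tperm a b * tperm a c \in G.
    move=> ab ac; have [-> | bc] := eqVneq b c; first by rewrite tperm2 group1.
    by apply: cyc3G; rewrite /= !inE negb_or ab ac bc.
  move=> xy zw; have [eq_xz | xz] := eqVneq x z; first by subst z; apply: shareG.
  (* Inserting [tperm x z] twice leaves two pairs of transpositions, each sharing a point. *)
  have -> : tperm x y * tperm z w = tperm x y * tperm x z * (tperm z x * tperm z w).
    by rewrite [tperm z x]tpermC mulgA -(mulgA (tperm x y)) tperm2 mulg1.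
  by apply: groupM; apply: shareG; rewrite // eq_sym.
apply/subsetP=> s; rewrite Alt_even; have [ts -> ts_diff] := prod_tpermP s.
rewrite odd_perm_prod //; have [n] := ubnP (size ts).
elim: n ts ts_diff => // n IHn [|p [|q ts]] //=; first by rewrite big_nil group1.
case/and3P=> p_diff q_diff ts_diff; rewrite negbK => le_ts_n ts_even.
by rewrite !big_cons mulgA groupM ?pairG ?IHn // ltnW.
Qed.

End ThreeCycles.

(** * Generation by a point-fixing long cycle *)

Section Generation.

Variable T : finType.
Implicit Types (s t u g h : {perm T}) (x y z w f : T) (G : {group {perm T}}).

(** A cycle whose length is coprime to all others is isolated by a power; the product of the other
    lengths is the modulus in [cycle_power]. *)
Lemma has_type_power k ks s : sumn (k :: ks) = #|T| -> has_type (k :: ks) s ->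
    all (coprime k) ks ->
  exists c cs n, [/\ size c = k, map size cs = ks, cycle_decomp s (c :: cs),
    {in c, s ^+ n =1 s} & {in [predC c], s ^+ n =1 id}].
Proof.
move=> ksT s_ks co_ks.
have [[|c cs] [//= [c_k cs_ks] cs_uniq cs_cyc _]] := has_type_decomp ksT s_ks.
have [|d d_cs||n [n1 n2]] := @cycle_power _ s c cs (\prod_(l <- ks) l) _ cs_uniq cs_cyc.
- by rewrite /= c_k cs_ks.
- have : size d \in ks by rewrite -cs_ks map_f.
  by move=> d_ks; rewrite (perm_big _ (perm_to_rem d_ks)) big_cons dvdn_mulr.
- rewrite c_k; elim: ks {ksT s_ks cs_ks} co_ks => [|l ks IHks] /=.
    by rewrite big_nil coprimen1.
  by case/andP=> kl /IHks; rewrite big_cons coprimeMr kl.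
exists c, cs, n; split=> //; rewrite /cycle_decomp [flatten _]/= cs_uniq.
exact/allP.
Qed.

Lemma has_type_tperm ks h : sumn (2 :: ks) = #|T| -> has_type (2 :: ks) h ->
  all odd ks -> exists x y, x != y /\ tperm x y \in <[h]>.
Proof.
move=> ksT h_ks ks_odd; have [|c [cs [n [c2 _ /andP[]]]]] := has_type_power ksT h_ks.
  by apply: sub_all ks_odd => k; rewrite coprime2n.
case: c c2 => [|x [|y [|? ?]]] //= _ /andP[+ _]; rewrite inE negb_or => /andP[xy _].
case/andP=> /and3P[/eqP hx /eqP hy _] _ hn_c hn_out.
exists x, y; split=> //; suff -> : tperm x y = h ^+ n by apply: mem_cycle.
apply/permP=> z; case: tpermP => [-> | -> | /eqP zx /eqP zy].
- by rewrite hn_c ?mem_head // hx.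
- by rewrite hn_c ?hy // !inE eqxx orbT.
by rewrite hn_out // !inE negb_or zx.
Qed.

(** The decomposition of [h] is returned along with the 3-cycle because the argument in odd degree
    also follows the other cycles of [h]. *)
Lemma has_type_cyc3_decomp ks h : sumn (3 :: ks) = #|T| -> has_type (3 :: ks) h ->
    all (coprime 3) ks ->
  exists x y z cs, [/\ map size cs = ks, cycle_decomp h ([:: x; y; z] :: cs),
    uniq [:: x; y; z] & cyc3 x y z \in <[h]>].
Proof.
move=> ksT h_ks ks_3; have [c [cs [n [+ cs_ks]]]] := has_type_power ksT h_ks ks_3.
case: c => [|x [|y [|z [|? ?]]]] // _ /[dup] decomp_h /andP[+ /andP[+ _]].
rewrite (cat_uniq [:: x; y; z]) => /andP[xyz _].
case/and4P=> /eqP hx /eqP hy /eqP hz _ hn_c hn_out.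
exists x, y, z, cs; split=> //; suff -> : cyc3 x y z = h ^+ n by apply: mem_cycle.
have [sx sy sz] := cyc3_val xyz; apply/permP=> w; have [|] := boolP (w \in [:: x; y; z]).
  move=> w_in; rewrite hn_c //; move: w_in; rewrite !inE => /or3P[] /eqP->.
  - by rewrite sx hx.
  - by rewrite sy hy.
  - by rewrite sz hz.
by move=> w_out; rewrite cyc3_out // hn_out.
Qed.

Lemma has_type_cyc3 ks h : sumn (3 :: ks) = #|T| -> has_type (3 :: ks) h ->
  all (coprime 3) ks -> exists x y z, uniq [:: x; y; z] /\ cyc3 x y z \in <[h]>.
Proof.
move=> ksT h_ks /(has_type_cyc3_decomp ksT h_ks)[x [y [z [cs [_ _ xyz xyz_h]]]]].
by exists x, y, z.
Qed.

Lemma cycle_trans s (c : seq T) x y : fcycle s c -> x \in c -> y \in c ->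
  exists2 u, u \in <[s]> & u x = y.
Proof.
move=> c_cyc xc; rewrite -(fconnect_cycle c_cyc xc) => /iter_findex <-.
by exists (s ^+ findex s x y); rewrite ?mem_cycle ?permX.
Qed.

Lemma has_type_pointfix k g : k.+1 = #|T| -> has_type [:: k; 1%N] g ->
  exists2 f, g f = f &
    forall x y, x != f -> y != f -> exists2 u, u \in <[g]> & u x = y.
Proof.
move=> kT; case/has_type_decomp=> [|cs]; first by rewrite /= addn0 addn1.
case: cs => [|c [|d [|? ?]]] [//= [_ d1] cs_uniq cs_cyc cs_all].
case: d d1 cs_uniq cs_cyc cs_all => [|f []] //= _ _ cs_cyc cs_all.
exists f => [|x y xf yf].
  by have := cs_cyc [:: f]; rewrite !inE eqxx orbT /= andbT => /(_ isT)/eqP.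
have inc z : z != f -> z \in c.
  by have := cs_all z; rewrite mem_cat inE orbC; case: eqP.
by apply: cycle_trans (inc _ xf) (inc _ yf); rewrite cs_cyc ?mem_head.
Qed.

(** The cycle through a fixed point [x] would be contained in [[:: x]]. *)
Lemma has_type_fixfree ks h x : sumn ks = #|T| -> has_type ks h -> all (ltn 1%N) ks ->
  h x != x.
Proof.
move=> ksT /(has_type_decomp ksT)[cs [<- cs_uniq cs_cyc cs_all]] ks_gt1.
have /flattenP[c c_cs xc] := cs_all x; apply/eqP=> hx.
have := allP ks_gt1 _ (map_f size c_cs); rewrite /= ltnNge => /negP[].
apply: (@uniq_leq_size _ _ [:: x]) => [|y]; first exact: uniq_flatten_mem c_cs.
rewrite -(fconnect_cycle (cs_cyc c c_cs) xc) => /iter_findex <-.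
by rewrite iter_fix ?inE.
Qed.

(** * Groups moving [f] whose stabilizer of [f] is transitive on the other points *)

Section TwoTransitive.

Variables (G : {group {perm T}}) (f : T) (h : {perm T}).
Hypothesis G_f : forall x y, x != f -> y != f ->
  exists2 u, u \in G & u f = f /\ u x = y.
Hypotheses (hG : h \in G) (h_f : h f != f).

Let trans_f x : exists2 u, u \in G & u f = x.
Proof.
have [-> | xf] := eqVneq x f; first by exists 1; rewrite ?group1 ?perm1.
have [u uG [_ u_x]] := G_f h_f xf.
by exists (h * u); rewrite ?groupM // permM.
Qed.

(** Transitivity moves the transposition to one of the form [tperm f b]; the stabilizer of [f] then
    yields every [tperm f w], and these generate Sym. *)
Lemma Sym_sub_of_tperm x y : x != y -> tperm x y \in G -> 'Sym_T \subset G.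
Proof.
move=> xy xyG; have [u uG ux] := trans_f x; pose b := u^-1 y.
have bf : b != f by rewrite -(inj_eq (@perm_inj _ u)) permKV ux eq_sym.
have fbG : tperm f b \in G.
  by rewrite -(groupJr _ uG) tpermJ ux permKV.
rewrite /Sym -(gen_tperm f) gen_subG; apply/subsetP=> _ /imsetP[w _ ->].
have [-> | wf] := eqVneq w f; first by rewrite tperm1 group1.
have [v vG [v_f <-]] := G_f bf wf.
by rewrite -{1}v_f -tpermJ groupJ.
Qed.

(** The 3-cycle links [f] to some [b]; the stabilizer of [f] carries [b] to every other point, so
    [f] is linked to all points. *)
Lemma Alt_sub_of_cyc3_mem x y z : uniq [:: x; y; z] -> cyc3 x y z \in G -> 'Alt_T \subset G.
Proof.
move=> xyz xyzG; have [u uG ux] := trans_f x; pose b := u^-1 y.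
have xy : x != y by move: xyz; rewrite /= inE; case: (x == y).
have bf : b != f by rewrite -(inj_eq (@perm_inj _ u)) permKV ux eq_sym.
have fb : cyc3_linked G f b.
  have -> : f = u^-1 x by rewrite -ux permK.
  apply: cyc3_linkedJ; rewrite ?groupV //; apply/cyc3_linkedP; right.
  by exists z.
have f_all w : cyc3_linked G f w.
  have [-> | wf] := eqVneq w f; first exact: cyc3_linked_refl.
  have [v vG [v_f <-]] := G_f bf wf.
  by rewrite -{1}v_f cyc3_linkedJ.
apply/Alt_sub_of_cyc3/cyc3_linked_cyc3 => v w.
by apply: cyc3_linked_trans (f_all w); rewrite cyc3_linked_sym.
Qed.

End TwoTransitive.

End Generation.

(** * Lower bounds for [kappa] from two cycle types *)

(** Conjugation-invariant properties stand for the two classes, so that [genG] applies to every pair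
    of representatives; incompatible properties make the classes distinct. *)
Lemma kappa_ge2 (gT : finGroupType) (G : {group gT}) (P Q : gT -> Prop) :
    (forall g u, P g -> P (g ^ u)) -> (forall h u, Q h -> Q (h ^ u)) ->
    (exists2 g, g \in G & P g) -> (exists2 h, h \in G & Q h) ->
    (forall g, P g -> Q g -> False) ->
    (forall g h, g \in G -> h \in G -> P g -> Q h -> G \subset <<[set g; h]>>) ->
  2 <= kappa G.
Proof.
move=> PJ QJ [g gG Pg] [h hG Qh] PQ genG.
have gh : g ^: G != h ^: G.
  apply/eqP=> eq_gh; have /imsetP[u _ def_g] : g \in h ^: G by rewrite -eq_gh class_refl.
  by apply: (PQ g) => //; rewrite def_g; apply: QJ.
pose X := [set g ^: G; h ^: G]; have X2 : #|X| = 2 by rewrite cards2 gh.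
rewrite /kappa -X2; apply: leq_bigmax_cond; rewrite X2 andbT.
apply/andP; split; first by apply/subsetP=> C /set2P[] ->; apply: mem_classes.
have gen u v : u \in g ^: G -> v \in h ^: G -> <<[set u; v]>> == G.
  case/imsetP=> a aG ->; case/imsetP=> b bG ->.
  rewrite eqEsubset genG ?groupJ ?andbT //; [|exact: PJ|exact: QJ].
  by rewrite gen_subG; apply/subsetP=> w /set2P[] ->; apply: groupJ.
apply/forall_inP=> C XC; apply/forall_inP=> D XD; apply/implyP=> CD.
apply/forall_inP=> u uC; apply/forall_inP=> v vD.
move: XC XD CD => /set2P[] eqC /set2P[] eqD; rewrite eqC eqD ?eqxx // => _.
  by rewrite gen // -?eqC -?eqD.
by rewrite setUC gen // -?eqC -?eqD.
Qed.

Section Types.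

Variable T : finType.
Implicit Types (s t u g h : {perm T}) (x y z w f : T) (G : {group {perm T}}).

(** The length of the cycle through a point is the order of that point under [s], hence the same in
    every decomposition. Positivity of [k] rules out empty lists. *)
Lemma has_type_mem ks ls s k : sumn ks = #|T| -> sumn ls = #|T| ->
  has_type ks s -> has_type ls s -> 0 < k -> k \in ks -> k \in ls.
Proof.
move=> ksT lsT /(has_type_decomp ksT)[cs [<- cs_uniq cs_cyc _]].
move=> /(has_type_decomp lsT)[ds [<- ds_uniq ds_cyc ds_all]] k_gt0 /mapP[c c_cs k_c].
case: c k_c c_cs => [|x c] k_c c_cs; first by rewrite k_c in k_gt0.
have /flattenP[d d_ds xd] := ds_all x.
apply/mapP; exists d => //; rewrite k_c.
rewrite -(order_cycle (cs_cyc _ c_cs) (uniq_flatten_mem cs_uniq c_cs) (mem_head x c)).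
exact: (order_cycle (ds_cyc _ d_ds) (uniq_flatten_mem ds_uniq d_ds) xd).
Qed.

(** Parity is invariant under conjugation, so it can be read off the representative built in
    [has_type_exists]. *)
Lemma has_type_odd ks s : sumn ks = #|T| -> has_type ks s ->
  odd_perm s = odd (sumn (map predn ks)).
Proof.
move=> ksT s_ks; have [t t_ks <-] := has_type_exists ksT.
by have [u ->] := has_type_conj ksT t_ks s_ks; rewrite odd_permJ.
Qed.

Lemma Sym_sub_of_odd G s : 'Alt_T \subset G -> s \in G -> odd_perm s -> 'Sym_T \subset G.
Proof.
move=> AG sG s_odd; apply/subsetP=> t _.
have [t_odd | t_even] := boolP (odd_perm t); last by apply: (subsetP AG); rewrite Alt_even.
rewrite -(mulgKV s t) groupM // (subsetP AG) // Alt_even odd_permM odd_permV.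
by rewrite t_odd s_odd.
Qed.

Lemma kappa_types_ge2 (G : {group {perm T}}) ks ls k :
    sumn ks = #|T| -> sumn ls = #|T| ->
    (forall s, has_type ks s -> s \in G) -> (forall s, has_type ls s -> s \in G) ->
    0 < k -> k \in ks -> k \notin ls ->
    (forall g h, has_type ks g -> has_type ls h -> G \subset <<[set g; h]>>) ->
  2 <= kappa G.
Proof.
move=> ksT lsT ksG lsG k_gt0 k_ks k_ls genG.
apply: (@kappa_ge2 _ G (has_type ks) (has_type ls)).
- by move=> g u; apply: has_typeJ.
- by move=> g u; apply: has_typeJ.
- by have [s s_ks _] := has_type_exists ksT; exists s; rewrite ?ksG.
- by have [s s_ls _] := has_type_exists lsT; exists s; rewrite ?lsG.
- move=> g g_ks g_ls; case/negP: k_ls.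
  exact: has_type_mem ksT lsT g_ks g_ls k_gt0 k_ks.
by move=> g h _ _; apply: genG.
Qed.

Section PointFixing.

Variables (k : nat) (ls : seq nat).
Hypotheses (kT : k.+1 = #|T|) (lsT : sumn ls = #|T|) (ls_gt1 : all (ltn 1%N) ls).

Let ksT : sumn [:: k; 1%N] = #|T|. Proof. by rewrite /= addn0 addn1. Qed.

Variables (g h : {perm T}).
Hypotheses (g_ks : has_type [:: k; 1%N] g) (h_ls : has_type ls h).
Let H := <<[set g; h]>>.

(** Powers of [g] fix its fixed point [f] and act transitively on the rest, while [h] moves every
    point. *)
Let point_trans : exists f, [/\ h \in H, h f != f &
  forall x y, x != f -> y != f -> exists2 u, u \in H & u f = f /\ u x = y].
Proof.
have [f gf g_trans] := has_type_pointfix kT g_ks; exists f; split.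
- by rewrite mem_gen // set22.
- exact: has_type_fixfree lsT h_ls ls_gt1.
move=> x y xf yf; have [u ug u_x] := g_trans x y xf yf; exists u.
  by apply: subsetP ug; rewrite cycle_subG mem_gen // set21.
by split=> //; have /cycleP[i ->] := ug; rewrite permX_fix.
Qed.

Lemma Sym_sub_point_fixing x y : x != y -> tperm x y \in H -> 'Sym_T \subset H.
Proof.
have [f [hH hf H_f]] := point_trans.
exact: (Sym_sub_of_tperm (G := <<[set g; h]>>%G) H_f hH hf).
Qed.

Lemma Alt_sub_point_fixing x y z :
  uniq [:: x; y; z] -> cyc3 x y z \in H -> 'Alt_T \subset H.
Proof.
have [f [hH hf H_f]] := point_trans.
exact: (Alt_sub_of_cyc3_mem (G := <<[set g; h]>>%G) H_f hH hf).
Qed.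

End PointFixing.

Lemma kappa_Sym_point_ge2 k ls : k.+1 = #|T| -> sumn ls = #|T| -> all (ltn 1%N) ls ->
    (forall g h, has_type [:: k; 1%N] g -> has_type ls h ->
      'Sym_T \subset <<[set g; h]>>) ->
  2 <= kappa 'Sym_T.
Proof.
move=> kT lsT ls_gt1 genS.
have ksT : sumn [:: k; 1%N] = #|T| by rewrite /= addn0 addn1.
(* The length 1 separates the two types, since all entries of [ls] exceed 1. *)
apply: (kappa_types_ge2 (k := 1) ksT lsT) => //; try by move=> s _; apply: in_setT.
  by rewrite !inE eqxx orbT.
by apply/negP=> /(allP ls_gt1).
Qed.

Lemma kappa_Alt_point_ge2 k ls : k.+1 = #|T| -> sumn ls = #|T| -> all (ltn 1%N) ls ->
    odd k -> ~~ odd (sumn (map predn ls)) ->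
    (forall g h, has_type [:: k; 1%N] g -> has_type ls h ->
      exists x y z, uniq [:: x; y; z] /\ cyc3 x y z \in <<[set g; h]>>) ->
  2 <= kappa 'Alt_T.
Proof.
move=> kT lsT ls_gt1 k_odd ls_even genA.
have ksT : sumn [:: k; 1%N] = #|T| by rewrite /= addn0 addn1.
apply: (kappa_types_ge2 (k := 1) ksT lsT) => //.
- move=> s s_ks; rewrite Alt_even (has_type_odd ksT s_ks) /=; lia.
- by move=> s s_ls; rewrite Alt_even (has_type_odd lsT s_ls).
- by rewrite !inE eqxx orbT.
- by apply/negP=> /(allP ls_gt1).
move=> g h g_ks h_ls; have [x [y [z [xyz xyzG]]]] := genA g h g_ks h_ls.
exact: (Alt_sub_point_fixing kT lsT ls_gt1 g_ks h_ls xyz xyzG).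
Qed.

End Types.

(** * Symmetric groups, and alternating groups of even degree *)

Lemma kappa_Sym_ge2 n : n \notin [:: 0; 1; 2; 3; 4; 6]%N -> 2 <= kappa 'Sym_('I_n).
Proof.
move=> n_ok; have n_gt4 : 4 < n by move: n n_ok => [|[|[|[|[]]]]].
have kT : n.-1.+1 = #|'I_n| by rewrite card_ord; lia.
(* The remaining lengths must be odd, so that a power of [h] is a transposition, and larger than 1.
   Degree 6 fails because [n - 5] would be 1. *)
pose ls := if odd n then [:: n - 2] else [:: 3; n - 5].
have ls_gt1 : all (ltn 1%N) (2 :: ls).
  by rewrite /ls; case: ifP => n_odd /=; move: n_ok; rewrite !inE; lia.
have ls_odd : all odd ls.
  by rewrite /ls; case: ifP => n_odd /=; lia.
have lsT : sumn (2 :: ls) = #|'I_n|.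
  by rewrite card_ord /ls; case: ifP => n_odd /=; lia.
apply: (kappa_Sym_point_ge2 kT lsT ls_gt1) => g h g_ks h_ls.
have [x [y [xy xy_h]]] := has_type_tperm lsT h_ls ls_odd.
apply: (Sym_sub_point_fixing kT lsT ls_gt1 g_ks h_ls xy).
by apply: subsetP xy_h; rewrite cycle_subG mem_gen // set22.
Qed.

Lemma kappa_Alt_even_ge2 n : ~~ odd n -> n \notin [:: 0; 2; 4; 6]%N -> 2 <= kappa 'Alt_('I_n).
Proof.
move=> n_even n_ok; have n_gt7 : 7 < n by move: n n_ok n_even; do 8 case=> //.
have kT : n.-1.+1 = #|'I_n| by rewrite card_ord; lia.
(* The remaining lengths must be prime to 3. If 3 divides [n] then [n - 3] is not, whereas [n - 7]
   is 2 modulo 3; the two cycles of length 2 keep the permutation even. *)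
pose ls := if 3 %| n then [:: 2; 2; n - 7] else [:: n - 3].
have ls_gt1 : all (ltn 1%N) (3 :: ls).
  by rewrite /ls; case: ifP => n_odd /=; lia.
have ls_3 : all (coprime 3) ls.
  by rewrite /ls; case: ifP => n3 /=; rewrite !prime_coprime //; lia.
have lsT : sumn (3 :: ls) = #|'I_n|.
  by rewrite card_ord /ls; case: ifP => n3 /=; lia.
apply: (kappa_Alt_point_ge2 kT lsT ls_gt1).
- lia.
- by rewrite /ls; case: ifP => n3 /=; lia.
move=> g h g_ks h_ls.
have [x [y [z [xyz xyz_h]]]] := has_type_cyc3 lsT h_ls ls_3.
exists x, y, z; split=> //.
by apply: subsetP xyz_h; rewrite cycle_subG mem_gen // set22.
Qed.

(** In this degree the point-fixing element [g] is itself the transposition, and the 3-cycle [h] has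
    no fixed point. *)
Lemma kappa_Sym3_ge2 : 2 <= kappa 'Sym_('I_3).
Proof.
have kT : 3 = #|'I_3| by rewrite card_ord.
have lsT : sumn [:: 3] = #|'I_3| by rewrite card_ord.
apply: (kappa_Sym_point_ge2 kT lsT isT) => g h g_ks h_ls.
have [x [y [xy xy_g]]] := has_type_tperm (ks := [:: 1%N]) kT g_ks isT.
apply: (Sym_sub_point_fixing kT lsT isT g_ks h_ls xy).
by apply: subsetP xy_g; rewrite cycle_subG mem_gen // set21.
Qed.

(** The 3-cycle [g] leads to Alt(4), and the 4-cycle [h] is odd. *)
Lemma kappa_Sym4_ge2 : 2 <= kappa 'Sym_('I_4).
Proof.
have kT : 4 = #|'I_4| by rewrite card_ord.
have lsT : sumn [:: 4] = #|'I_4| by rewrite card_ord.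
apply: (kappa_Sym_point_ge2 kT lsT isT) => g h g_ks h_ls.
have [x [y [z [xyz xyz_g]]]] := has_type_cyc3 (ks := [:: 1%N]) kT g_ks isT.
apply: (@Sym_sub_of_odd _ <<[set g; h]>>%G h).
- apply: (Alt_sub_point_fixing kT lsT isT g_ks h_ls xyz).
  by apply: subsetP xyz_g; rewrite cycle_subG mem_gen // set21.
- by rewrite mem_gen // set22.
by rewrite (has_type_odd lsT h_ls).
Qed.

Lemma kappa_Alt4_ge2 : 2 <= kappa 'Alt_('I_4).
Proof.
have kT : 4 = #|'I_4| by rewrite card_ord.
have lsT : sumn [:: 2; 2] = #|'I_4| by rewrite card_ord.
apply: (kappa_Alt_point_ge2 kT lsT isT isT isT) => g h g_ks h_ls.
have [x [y [z [xyz xyz_g]]]] := has_type_cyc3 (ks := [:: 1%N]) kT g_ks isT.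
exists x, y, z; split=> //.
by apply: subsetP xyz_g; rewrite cycle_subG mem_gen // set21.
Qed.

(** * Alternating groups of odd degree *)

Lemma uniq_flatten_cat (T : eqType) (c d : seq T) (cs : seq (seq T)) :
  uniq (flatten (c :: cs)) -> d \in cs -> uniq (c ++ d).
Proof.
move=> /= cs_uniq d_cs; move: cs_uniq.
rewrite (perm_uniq (s2 := c ++ d ++ flatten (rem d cs))).
  by rewrite catA cat_uniq => /andP[].
by rewrite perm_cat2l (perm_flatten (perm_to_rem d_cs)).
Qed.

Section LongCycle.

Variable T : finType.
Implicit Types (s t u g h : {perm T}) (x y z w f : T) (G : {group {perm T}}).

Definition link_class G x := [set y | cyc3_linked G x y].

(** Linking is preserved by [h], so a class that links [x] to [h x] is mapped into itself and
    contains every cycle of [h] that it meets. *)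
Lemma link_class_perm G h x c y : h \in G -> cyc3_linked G x (h x) ->
  fcycle h c -> y \in c -> y \in link_class G x -> {subset c <= link_class G x}.
Proof.
move=> hG xhx c_cyc yc; rewrite inE => xy z.
rewrite -(fconnect_cycle c_cyc yc) inE => /iter_findex <-.
elim: (findex _ _ _) => //= n IHn; apply: cyc3_linked_trans xhx _.
exact: cyc3_linkedJ.
Qed.

Section Transitive.

Variable G : {group {perm T}}.
Hypothesis G_trans : forall x y, exists2 u, u \in G & u x = y.

(** The classes partition [T] and are permuted transitively by [G], hence have equal sizes. *)
Lemma card_link_class_dvd x : #|link_class G x| %| #|T|.
Proof.
have eq_link : {in setT & &, equivalence_rel (cyc3_linked G)}.
  move=> y z w _ _ _; split=> [|yz]; first exact: cyc3_linked_refl.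
  apply/idP/idP; apply: cyc3_linked_trans => //.
  by rewrite cyc3_linked_sym.
have /card_uniform_partition : partition (equivalence_partition (cyc3_linked G) setT) setT.
  exact: equivalence_partitionP.
move/(_ #|link_class G x|); rewrite cardsT => ->; first exact: dvdn_mull.
move=> _ /imsetP[y _ ->]; have [u uG <-] := G_trans x y.
rewrite -[RHS](card_imset _ (@perm_inj _ u)); apply: eq_card => z.
rewrite !inE -[z](permKV u) mem_imset; last exact: perm_inj.
rewrite !inE. apply/idP/idP; last exact: cyc3_linkedJ.
by move/(cyc3_linkedJ (groupVr uG)); rewrite !permK.
Qed.

Lemma Alt_sub_link_class x : #|T| < 2 * #|link_class G x| -> 'Alt_T \subset G.
Proof.
move=> class_large; have /dvdnP[q Tq] := card_link_class_dvd x.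
have T_gt0 : 0 < #|T| by apply/card_gt0P; exists x.
have q1 : q = 1%N by case: q Tq => [|[|q]] Tq //; nia.
have link_x y : cyc3_linked G x y.
  have /subset_cardP : #|link_class G x| = #|T| by rewrite Tq q1 mul1n.
  by move=> /(_ (subset_predT _))/(_ y); rewrite inE => ->.
apply/Alt_sub_of_cyc3/cyc3_linked_cyc3 => v w.
by apply: cyc3_linked_trans (link_x w); rewrite cyc3_linked_sym.
Qed.

End Transitive.

Lemma has_type_transitive g x y : has_type [:: #|T|] g -> exists2 u, u \in <[g]> & u x = y.
Proof.
case/has_type_decomp=> [|cs]; first by rewrite /= addn0.
case: cs => [|c [|? ?]] [//= _ _ cs_cyc]; rewrite cats0 => c_all.
by apply: cycle_trans (c_all x) (c_all y); rewrite cs_cyc ?mem_head.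
Qed.

Lemma leq_size_link_class G x (c : seq T) :
  uniq c -> {subset c <= link_class G x} -> size c <= #|link_class G x|.
Proof. by move=> /card_uniqP <- /subsetP/subset_leq_card. Qed.

Section Generation.

Variables g h : {perm T}.
Hypothesis g_long : has_type [:: #|T|] g.
Let G := <<[set g; h]>>%G.

Let G_trans x y : exists2 u, u \in G & u x = y.
Proof.
have [u ug ux] := has_type_transitive x y g_long; exists u => //.
by apply: subsetP ug; rewrite cycle_subG mem_gen // set21.
Qed.

Let hG : h \in G. Proof. by rewrite mem_gen // set22. Qed.

(** The class of [x] is stable under [h] and contains [x], [y], [z]. Its size is not 3, because 3
    does not divide [3 + 2m]; so it meets, hence contains, a cycle of length [m], and [3 + m]
    exceeds half the degree. *)
Lemma Alt_sub_3mm m : #|T| = (3 + (m + m))%N -> ~~ (3 %| m) -> has_type [:: 3; m; m] h ->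
  'Alt_T \subset G.
Proof.
move=> Tm m3 h_ls.
have lsT : sumn [:: 3; m; m] = #|T| by rewrite Tm /= addn0.
have ls_3 : all (coprime 3) [:: m; m] by rewrite /= prime_coprime // m3.
have [x [y [z [cs [cs_m h_cs xyz xyzh]]]]] := has_type_cyc3_decomp lsT h_ls ls_3.
have xc : x \in link_class G x by rewrite inE cyc3_linked_refl.
have xyzG : cyc3 x y z \in G by apply: subsetP xyzh; rewrite cycle_subG.
have [h_uniq /= /andP[h_xyz h_cyc]] := andP h_cs.
have xhx : cyc3_linked G x (h x).
  move: h_xyz => /andP[/eqP-> _]; apply/cyc3_linkedP; right.
  by exists z.
have stable (c : seq T) w : fcycle h c -> w \in c -> w \in link_class G x ->
    {subset c <= link_class G x} by exact: link_class_perm hG xhx.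
have xyz_class : {subset [:: x; y; z] <= link_class G x}.
  by apply: (stable _ x) => //; rewrite mem_head.
have class_gt3 : 3 < #|link_class G x|.
  rewrite ltn_neqAle (leq_size_link_class xyz xyz_class) andbT eq_sym.
  apply/eqP=> class3; move: (card_link_class_dvd G_trans x); rewrite class3 Tm.
  by rewrite dvdn_addr // addnn -muln2 Gauss_dvdl // (negPf m3).
have /subsetPn[v vx v_out] : ~~ (link_class G x \subset [:: x; y; z]).
  apply: contraL class_gt3 => /subset_leq_card class_le; rewrite -leqNgt.
  by apply: leq_trans class_le (card_size _).
have lsE : sumn (map size ([:: x; y; z] :: cs)) = #|T| by rewrite /= cs_m -lsT.
have := mem_uniq_flatten v h_uniq lsE; rewrite mem_cat (negPf v_out) /=.
case/flattenP=> c c_cs vc; have c_m : size c = m.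
  by have := map_f size c_cs; rewrite cs_m !inE orbb => /eqP.
have c_class := stable _ _ (allP h_cyc c c_cs) vc vx.
apply: (Alt_sub_link_class G_trans (x := x)); rewrite Tm.
have : size ([:: x; y; z] ++ c) <= #|link_class G x|.
  apply: leq_size_link_class; first exact: uniq_flatten_cat h_uniq c_cs.
  by move=> w; rewrite mem_cat => /orP[/xyz_class | /c_class].
rewrite size_cat c_m [size [:: _; _; _]]/=; move: #|link_class G x| => K; clear; lia.
Qed.

(** The class of the fixed point [f] is stable under [h] and has at least 3 points. If it meets the
    [m]-cycle, its size [1 + m] or more exceeds half the degree; otherwise it is exactly [f], [x],
    [y], [z], and 4 would divide an odd degree. *)
Lemma Alt_sub_31m m : #|T| = (4 + m)%N -> odd m -> 1 < m -> ~~ (3 %| m) ->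
  has_type [:: 3; 1%N; m] h -> 'Alt_T \subset G.
Proof.
move=> Tm m_odd m_gt1 m3 h_ls.
have lsT : sumn [:: 3; 1%N; m] = #|T| by rewrite Tm /= addn0.
have ls_3 : all (coprime 3) [:: 1%N; m] by rewrite /= prime_coprime // m3.
have [x [y [z [cs [cs_m h_cs xyz xyzh]]]]] := has_type_cyc3_decomp lsT h_ls ls_3.
case: cs cs_m h_cs => [|[|f [|? ?]] [|c [|? ?]]] // [c_m] /andP[h_uniq].
case/and4P=> h_xyz /andP[/eqP hf _] c_cyc _.
have fhf : cyc3_linked G f (h f) by rewrite hf cyc3_linked_refl.
have stable (d : seq T) w : fcycle h d -> w \in d -> w \in link_class G f ->
    {subset d <= link_class G f} by exact: link_class_perm hG fhf.
have ff : f \in link_class G f by rewrite inE cyc3_linked_refl.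
have h_size : sumn (map size ([:: [:: x; y; z]; [:: f]; c])) = #|T|.
  by rewrite /= c_m -lsT.
have cover := mem_uniq_flatten _ h_uniq h_size.
have fc_uniq : uniq (f :: c).
  by move: h_uniq => /=; rewrite cats0 => /and4P[_ _ _].
have fxyz_uniq : uniq ([:: x; y; z] ++ [:: f]).
  by apply: uniq_flatten_cat h_uniq _; rewrite mem_head.
have class_gt2 : 2 < #|link_class G f|.
  (* An element carrying [x] to [f] takes the linked points [y] and [z] into the class of [f]. *)
  have [u uG u_x] := G_trans x f.
  have uxyz : uniq [:: u x; u y; u z] by rewrite -(map_inj_uniq (@perm_inj _ u)) in xyz.
  apply: (leq_size_link_class uxyz); rewrite -u_x.
  have xyzG : cyc3 x y z \in G by apply: subsetP xyzh; rewrite cycle_subG.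
  move=> w; rewrite !inE => /or3P[]/eqP->; apply: cyc3_linkedJ => //.
  - exact: cyc3_linked_refl.
  - by apply/cyc3_linkedP; right; exists z.
  - rewrite cyc3_linked_sym; apply/cyc3_linkedP; right; exists y.
      by rewrite -(rot_uniq 1).
    have yzx : uniq [:: y; z; x] by rewrite -(rot_uniq 2).
    by rewrite (cyc3_rot yzx) (cyc3_rot xyz).
have [/hasP[v vc vf] | /hasPn noc] := boolP (has (mem (link_class G f)) c).
  apply: (Alt_sub_link_class G_trans (x := f)).
  have : size (f :: c) <= #|link_class G f|.
    apply: (leq_size_link_class fc_uniq) => w; rewrite inE => /predU1P[-> // |].
    exact: (stable c v).
  rewrite Tm [size _]/= c_m; move: #|link_class G f| => K; clear -m_odd m_gt1; lia.
have class_sub w : w \in link_class G f -> w \in [:: x; y; z] ++ [:: f].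
  move=> wf; have := cover w; rewrite -[flatten _]/([:: x; y; z] ++ [:: f] ++ c ++ [::]).
  by rewrite cats0 catA mem_cat => /orP[// | /noc/negP].
have /subsetPn[v vf v_f] : ~~ (link_class G f \subset [:: f]).
  apply: contraL class_gt2 => /subset_leq_card class_le; rewrite -leqNgt.
  by apply: leq_trans class_le (leq_trans (card_size _) _).
have v_xyz : v \in [:: x; y; z].
  by have := class_sub v vf; rewrite mem_cat (negPf v_f) orbF.
have class4 : #|link_class G f| = 4.
  rewrite -[4](card_uniqP fxyz_uniq); apply/eq_card => w; apply/idP/idP => [/class_sub //|].
  rewrite mem_cat => /orP[|]; first exact: (stable _ v).
  by rewrite inE => /eqP->.
have := card_link_class_dvd G_trans f; rewrite class4 Tm; clear -m_odd => m4; exfalso; lia.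
Qed.

End Generation.

End LongCycle.

(** The length [n] separates the types. If 3 divides [n] it also divides [(n - 3)./2], which rules
    out the type with two equal cycles, whereas [n - 4] is 2 modulo 3. *)
Lemma kappa_Alt_odd_ge2 n : odd n -> 4 < n -> 2 <= kappa 'Alt_('I_n).
Proof.
move=> n_odd n_gt4; have nT : sumn [:: n] = #|'I_n| by rewrite /= addn0 card_ord.
have gen ls : sumn ls = n -> n \notin ls -> ~~ odd (sumn (map predn ls)) ->
    (forall g h, has_type [:: n] g -> has_type ls h -> 'Alt_('I_n) \subset <<[set g; h]>>) ->
  2 <= kappa 'Alt_('I_n).
  move=> lsn n_ls ls_even genA; have lsT : sumn ls = #|'I_n| by rewrite card_ord.
  apply: (kappa_types_ge2 nT lsT _ _ (k := n)) => //.
  - by move=> s /(has_type_odd nT) s_odd; rewrite Alt_even s_odd /=; lia.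
  - by move=> s /(has_type_odd lsT) s_odd; rewrite Alt_even s_odd.
  - lia.
  - by rewrite mem_head.
have [n3 | n3] := boolP (3 %| n).
  apply: (gen [:: 3; 1%N; n - 4]) => [|||g h g_n h_ls] /=.
  - lia.
  - by rewrite !inE; lia.
  - lia.
  by apply: (@Alt_sub_31m _ g h _ (n - 4)); rewrite ?card_ord //; lia.
apply: (gen [:: 3; (n - 3)./2; (n - 3)./2]) => [|||g h g_n h_ls] /=.
- lia.
- by rewrite !inE; lia.
- lia.
by apply: (@Alt_sub_3mm _ g h _ (n - 3)./2); rewrite ?card_ord //; lia.
Qed.

(** The identity and any other element generate the group. This covers Sym(2) and Alt(3). *)
Lemma kappa_prime_ge2 (gT : finGroupType) (G : {group gT}) : prime #|G| -> 2 <= kappa G.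
Proof.
move=> G_pr; have G_ab : abelian G := cyclic_abelian (prime_cyclic G_pr).
have /trivgPn[x xG x1] : G :!=: 1 by rewrite -cardG_gt1 prime_gt1.
apply: (@kappa_ge2 _ G (eq^~ 1) (fun h => h != 1)).
- by move=> _ u ->; apply: conj1g.
- by move=> h u; rewrite conjg_eq1.
- by exists 1.
- by exists x.
- by move=> g -> /eqP.
move=> g h _ hG -> h1; have hgen : <<[set 1; h]>> = <[h]>.
  apply/eqP; rewrite eqEsubset gen_subG cycle_subG mem_gen ?set22 // andbT.
  by apply/subsetP=> w /set2P[] ->; rewrite ?group1 ?cycle_id.
have [| h_1] := prime_subgroupVti <[h]>%G G_pr; first by rewrite hgen.
by case/negP: h1; rewrite -cycle_eq1; move: h_1; rewrite (setIidPl _) ?cycle_subG // => ->.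
Qed.

(** * Degree six *)

(** Permutations are modelled on natural numbers so that the finite checks below can be
    evaluated. *)
Definition cycle_fun (ns : seq (seq nat)) (i : nat) : nat :=
  foldr (fun c j => if i \in c then next c i else j) i ns.

Lemma cycle_funE n (s : 'S_n) (cs : seq (seq 'I_n)) i :
  cycle_decomp s cs -> i \in flatten cs ->
  s i = cycle_fun (map (map val) cs) i :> nat.
Proof.
case/andP; elim: cs => //= c cs IHcs; rewrite cat_uniq mem_cat.
case/and3P=> c_uniq _ cs_uniq /andP[c_cyc cs_cyc].
rewrite (mem_map val_inj); case: ifP => [ic _ | _ /=]; last exact: IHcs.
by rewrite (next_map val_inj) // (nextE c_cyc).
Qed.

Lemma cycle_fun_conj n (ns : seq (seq nat)) (g : 'S_n.+1) :
    perm_eq (flatten ns) (iota 0 n.+1) -> has_type (map size ns) g ->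
  exists u, forall i, (g ^ u) i = cycle_fun ns i :> nat.
Proof.
move=> ns_perm g_ns; pose cs := map (map (@inord n)) ns.
have nsE : map (map val) cs = ns.
  rewrite -map_comp; apply: map_id_in => c c_ns; rewrite /= -map_comp.
  apply: map_id_in => i ic; rewrite /= inordK //.
  have : i \in flatten ns by apply/flattenP; exists c.
  by rewrite (perm_mem ns_perm) mem_iota.
have cs_uniq : uniq (flatten cs).
  rewrite -(map_inj_uniq val_inj) map_flatten nsE (perm_uniq ns_perm).
  exact: iota_uniq.
have sizeE : map size cs = map size ns.
  by rewrite -map_comp; apply: eq_map => c; rewrite /= size_map.
have nsT : sumn (map size ns) = #|'I_n.+1|.
  by rewrite card_ord -/(shape ns) -size_flatten (perm_size ns_perm) size_iota.
have [cs_cyc _ _] := prod_cyc cs_uniq; set t := \prod_(c <- cs) _ in cs_cyc.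
have t_cs : cycle_decomp t cs by rewrite /cycle_decomp cs_uniq.
have [|u tE] := has_type_conj nsT g_ns (t := t); first by exists cs.
exists u => i; rewrite -tE (cycle_funE t_cs) ?nsE // mem_uniq_flatten //.
by rewrite sizeE.
Qed.

(** For a moved point [x], both [s x] and [s (s x)] are moved. If [s (s x)] were [x], a third moved
    point [w] would bring [s w] as a fourth. *)
Lemma cyc3_of_card_moved (T : finType) (s : {perm T}) : #|[set x | s x != x]| = 3 ->
  exists x y z, uniq [:: x; y; z] /\ s = cyc3 x y z.
Proof.
set A := [set _ | _] => A3.
have sA w : (s w \in A) = (w \in A) by rewrite !inE (inj_eq perm_inj).
have /card_gt0P[x xA] : 0 < #|A| by rewrite A3.
have yA : s x \in A by rewrite sA.
have zA : s (s x) \in A by rewrite sA.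
have xy : x != s x by move: xA; rewrite inE eq_sym.
have yz : s x != s (s x) by rewrite (inj_eq perm_inj).
have xz : x != s (s x).
  apply/eqP=> eq_xz.
  have /subsetPn[w wA] : ~~ (A \subset [:: x; s x]).
    apply: contra_eqN A3 => /subset_leq_card/leq_trans/(_ (card_size _)).
    by case: #|A| => [|[|[|]]].
  rewrite !inE negb_or => /andP[wx wy].
  have : size [:: x; s x; w; s w] <= #|A|.
    rewrite -(card_uniqP _); last first.
      rewrite /= !inE !negb_or xy (eq_sym x) wx (eq_sym (s x)) wy (inj_eq perm_inj).
      rewrite {1}eq_xz (inj_eq perm_inj) !(eq_sym _ w) wy wx.
      by move: wA; rewrite inE eq_sym => ->.
    apply/subset_leq_card/subsetP=> v; rewrite !in_cons in_nil orbF.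
    by case/or4P=> /eqP-> //; rewrite sA.
  by rewrite A3.
have xyz : uniq [:: x; s x; s (s x)] by rewrite /= !inE negb_or xy yz xz.
have AE : A =i [:: x; s x; s (s x)].
  apply/fsym/subset_cardP; first by rewrite (card_uniqP xyz) A3.
  by apply/subsetP=> v; rewrite !in_cons in_nil orbF => /or3P[] /eqP->.
exists x, (s x), (s (s x)); split=> //.
have [cx cy cz] := cyc3_val xyz.
apply/permP=> v; have [|v_out] := boolP (v \in [:: x; s x; s (s x)]); last first.
  by rewrite cyc3_out //; move: v_out; rewrite -AE inE negbK => /eqP.
rewrite !in_cons in_nil orbF => /or3P[] /eqP->; rewrite ?cx ?cy ?cz //.
have : s (s (s x)) \in A by rewrite !sA.
rewrite AE !in_cons in_nil orbF !(inj_eq perm_inj) !(eq_sym _ x).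
by rewrite (negPf xz) (negPf xy) !orbF => /eqP.
Qed.

Definition word_fun (f1 f2 : nat -> nat) (w : seq bool) (i : nat) : nat :=
  foldl (fun j b => (if b then f2 else f1) j) i w.

Definition word_perm (T : finType) (g h : {perm T}) (w : seq bool) : {perm T} :=
  \prod_(b <- w) (if b then h else g).

Lemma word_permE n (g h : 'S_n) (f1 f2 : nat -> nat) w (i : 'I_n) :
  (forall j, g j = f1 j :> nat) -> (forall j, h j = f2 j :> nat) ->
  word_perm g h w i = word_fun f1 f2 w i :> nat.
Proof.
move=> gE hE; rewrite /word_perm; elim: w i => [|b w IHw] i.
  by rewrite big_nil perm1.
by rewrite big_cons permM IHw; case: b; rewrite ?gE ?hE.
Qed.

Lemma word_perm_mem (T : finType) (g h : {perm T}) w : word_perm g h w \in <<[set g; h]>>.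
Proof.
rewrite /word_perm; elim/big_ind: _ => [||b _]; [exact: group1 | exact: groupM |].
by case: b; rewrite mem_gen ?set22 ?set21.
Qed.

Lemma card_moved n (s : 'S_n) (f : nat -> nat) : (forall i, s i = f i :> nat) ->
  #|[set i | s i != i]| = count (fun i => f i != i) (iota 0 n).
Proof.
move=> sE; rewrite cardsE cardE size_filter -val_enum_ord count_map -enumT.
by apply: eq_count => i; rewrite /= -sE.
Qed.

Lemma gen_conj2 (gT : finGroupType) (g h u w : gT) :
  (w \in <<[set g ^ u; h ^ u]>>) = (w ^ u^-1 \in <<[set g; h]>>).
Proof.
rewrite -mem_conjg -genJ; congr (_ \in <<_>>).
by rewrite conjUg !conjg_set1.
Qed.

(* Found by a search: for every [h] of type (4,2), one of these words in the
   fixed 5-cycle (false) and [h] (true) is a 3-cycle. *)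
Definition words :=
  [:: [:: false; false; false; true; false; true; false; true; true];
      [:: false; false; true; false; false; true; false; true; true];
      [:: false; false; true; false; true; true; true; false; true];
      [:: false; false; true; true; false; true; true; false; true];
      [:: false; false; true; false; true; true; false; true];
      [:: false; false; false; true; false; false; true; true];
      [:: false; false; false; true; true; false; false; true]].

(** A listing [p] of the six points encodes an element of type (4,2): its first four entries form
    one cycle and the last two the other. A 3-cycle is recognised by moving exactly three points. *)
Definition gives_3cycle (p : seq nat) : bool :=
  let f1 := nth 0%N [:: 1; 2; 3; 4; 0; 5]%N in
  let f2 := nth 0%N (map (cycle_fun [:: take 4 p; drop 4 p]) (iota 0 6)) in
  has (fun w => count (fun i => word_fun f1 f2 w i != i) (iota 0 6) == 3) words.

Lemma gives_3cycle_all : all gives_3cycle (permutations (iota 0 6)).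
Proof. by vm_compute. Qed.

(** No power of an element of type (4,2) is a 3-cycle, so words in both elements are used.
    Conjugating the pair makes [g] a fixed 5-cycle; the check over all listings then covers every
    [h], and the 3-cycle found is conjugated back. *)
Lemma kappa_Alt6_ge2 : 2 <= kappa 'Alt_('I_6).
Proof.
have kT : 6 = #|'I_6| by rewrite card_ord.
have lsT : sumn [:: 4; 2] = #|'I_6| by rewrite card_ord.
apply: (kappa_Alt_point_ge2 kT lsT isT isT isT) => g h g_ks h_ls.
pose ns := [:: iota 0 5; [:: 5]].
have [u guE] : exists u, forall i, (g ^ u) i = cycle_fun ns i :> nat.
  exact: cycle_fun_conj.
have [cs [cs_42 cs_uniq cs_cyc cs_all]] := has_type_decomp lsT (has_typeJ u h_ls).
have h_cs : cycle_decomp (h ^ u) cs by rewrite /cycle_decomp cs_uniq; apply/allP.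
pose p := map val (flatten cs).
have p_perm : perm_eq (iota 0 6) p.
  rewrite -val_enum_ord; apply/perm_map/uniq_perm; rewrite ?enum_uniq //.
  by move=> i; rewrite mem_enum cs_all.
have csE : map (map val) cs = [:: take 4 p; drop 4 p].
  rewrite /p; move: cs_42 {cs_uniq cs_cyc cs_all h_cs p p_perm}.
  case: cs => [|c [|d [|? ?]]] // [c4 d2].
  by rewrite /= cats0 map_cat take_size_cat ?drop_size_cat ?size_map.
have /hasP[w _ /eqP w3] : gives_3cycle p.
  by apply: (allP gives_3cycle_all); rewrite mem_permutations perm_sym.
set f1 := nth _ _ in w3; set f2 := nth _ _ in w3.
have gE i : (g ^ u) i = f1 i :> nat.
  by rewrite guE; case: i => -[|[|[|[|[|[|]]]]]].
have hE i : (h ^ u) i = f2 i :> nat.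
  by rewrite (cycle_funE h_cs) // csE /f2 (nth_map 0%N) ?size_iota // nth_iota.
have WE i := word_permE w i gE hE.
have [|x [y [z [xyz WC]]]] := @cyc3_of_card_moved _ (word_perm (g ^ u) (h ^ u) w).
  by rewrite (card_moved WE).
exists (u^-1 x), (u^-1 y), (u^-1 z); split.
  by rewrite -(map_inj_uniq (@perm_inj _ u^-1)) in xyz.
by rewrite -cyc3J -gen_conj2 -WC word_perm_mem.
Qed.

(** * Overgroups in Sym(6) as stabilizers of sets of maps *)

(** For a permutation [f], the map [t'] is the conjugate of [t] by [f]. Arbitrary maps are allowed,
    so that a constant map encodes a point stabilizer. *)
Definition preserves (S : seq (seq nat)) (f : nat -> nat) : bool :=
  all (fun t => has (fun t' =>
    all (fun i => nth 0%N t' (f i) == f (nth 0%N t i)) (iota 0 6)) S) S.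

Definition nat_fun (s : 'S_6) (i : nat) : nat := s (inord i).

Definition stabilizer S := [set s : 'S_6 | preserves S (nat_fun s)].

Lemma eq_preserves S f1 f2 : all (all (gtn 6)) S -> {in gtn 6, f1 =1 f2} ->
  preserves S f1 = preserves S f2.
Proof.
move=> S6 f12; apply: eq_in_all => t tS; apply: eq_has => t'; apply: eq_in_all => i.
rewrite mem_iota add0n => /andP[_ i6]; rewrite !f12 // inE.
(* Beyond the end of [t] the default 0 is returned, which is also below 6. *)
have [lt_it | le_ti] := ltnP i (size t); last by rewrite nth_default.
by have /allP/(_ _ (mem_nth 0%N lt_it)) := allP S6 t tS.
Qed.

(** In a finite group, closure under products suffices; matching maps are chained through the
    intermediate one. *)
Lemma stabilizer_group S : all (all (gtn 6)) S -> group_set (stabilizer S).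
Proof.
move=> S6; apply/group_setP; split=> [|s t].
  rewrite inE (@eq_preserves _ _ id) //.
    by apply/allP=> t tS; apply/hasP; exists t => //; apply/allP=> i _.
  by move=> i i6; rewrite /nat_fun perm1 inordK.
rewrite !inE => /allP s_pres /allP t_pres; apply/allP=> a aS.
have /hasP[b bS /allP ab] := s_pres a aS; have /hasP[c cS /allP bc] := t_pres b bS.
apply/hasP; exists c => //; apply/allP=> i i6.
have stE j : nat_fun (s * t) j = nat_fun t (nat_fun s j).
  by rewrite /nat_fun permM inord_val.
rewrite !stE -(eqP (ab i i6)); apply: bc.
by rewrite mem_iota add0n /= ltn_ord.
Qed.

(* Nonincreasing lists of sum [n] with parts at most [m]; [d] is fuel. *)
Fixpoint parts (d m n : nat) : seq (seq nat) :=
  if d is d'.+1 then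
    if n == 0 then [:: [::]]
    else [seq k :: l | k <- iota 1 (minn m n), l <- parts d' k (n - k)]
  else [:: [::]].

Lemma mem_parts d m n (ks : seq nat) : path geq m ks -> all (ltn 0) ks ->
  sumn ks = n -> n <= d -> ks \in parts d m n.
Proof.
elim: d m n ks => [|d IHd] m n [|k ks] //=.
- by move=> _ /andP[]; lia.
- by move=> _ _ <-.
case/andP=> km ks_sorted /andP[k_gt0 ks_gt0] def_n le_nd.
have -> : (n == 0) = false by lia.
apply/allpairsPdep; exists k, ks; split=> //; first by rewrite mem_iota; lia.
by apply: IHd => //; lia.
Qed.

(** Sorting the cycles by length brings every type into the form enumerated by [parts], leaving a
    finite check. *)
Lemma has_type_sorted (T : finType) (s : {perm T}) :
  exists2 ks, has_type ks s & [/\ sorted geq ks, all (ltn 0) ks & sumn ks = #|T|].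
Proof.
have [cs [/andP[cs_uniq cs_cyc] cs_size cs_gt0]] := cycle_decomp_exists s.
pose ds := sort (fun c d : seq T => geq (size c) (size d)) cs.
have ds_cs : perm_eq ds cs by rewrite perm_sort.
exists (map size ds); first exists ds => //.
  by rewrite /cycle_decomp (perm_uniq (perm_flatten ds_cs)) cs_uniq (perm_all _ ds_cs).
split.
- rewrite sorted_map; apply: sort_sorted => c d /=; exact: leq_total.
- by rewrite (perm_all _ (perm_map size ds_cs)).
by rewrite (perm_sumn (perm_map size ds_cs)) -cs_size size_flatten.
Qed.

Definition odd_type (ks : seq nat) : bool := odd (sumn (map predn ks)).

(* Each entry lists maps whose set has as stabilizer a subgroup of Sym(6),
   and elements of that subgroup, one for each of the cycle types needed.  The
   subgroups are the point stabilizer, Sym(4) x Sym(2), Sym(3) wr Sym(2)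
   and PGL(2,5), whose five maps are the synthemes of a synthematic total. *)
Definition overgroups : seq (seq (seq nat) * seq (seq (seq nat))) :=
  [:: ([:: [:: 5; 5; 5; 5; 5; 5]],
       [:: [:: [:: 0]; [:: 1]; [:: 2]; [:: 3]; [:: 4]; [:: 5]];
           [:: [:: 3; 4]; [:: 0]; [:: 1]; [:: 2]; [:: 5]];
           [:: [:: 1; 2]; [:: 3; 4]; [:: 0]; [:: 5]];
           [:: [:: 2; 3; 4]; [:: 0; 1]; [:: 5]];
           [:: [:: 0; 1; 2; 3; 4]; [:: 5]]]);
      ([:: [:: 0; 1; 2; 3; 5; 4]],
       [:: [:: [:: 4; 5]; [:: 0]; [:: 1]; [:: 2]; [:: 3]];
           [:: [:: 1; 2; 3]; [:: 0]; [:: 4]; [:: 5]];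
           [:: [:: 1; 2; 3]; [:: 4; 5]; [:: 0]];
           [:: [:: 0; 1]; [:: 2; 3]; [:: 4; 5]];
           [:: [:: 0; 1; 2; 3]; [:: 4]; [:: 5]];
           [:: [:: 0; 1; 2; 3]; [:: 4; 5]]]);
      ([:: [:: 1; 2; 0; 4; 5; 3]; [:: 1; 2; 0; 5; 3; 4];
           [:: 2; 0; 1; 4; 5; 3]; [:: 2; 0; 1; 5; 3; 4]],
       [:: [:: [:: 4; 5]; [:: 0]; [:: 1]; [:: 2]; [:: 3]];
           [:: [:: 3; 4; 5]; [:: 0]; [:: 1]; [:: 2]];
           [:: [:: 3; 4; 5]; [:: 1; 2]; [:: 0]];
           [:: [:: 0; 1; 2]; [:: 3; 4; 5]];
           [:: [:: 1; 4; 2; 5]; [:: 0; 3]];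
           [:: [:: 0; 3; 1; 4; 2; 5]]]);
      ([:: [:: 1; 0; 4; 5; 2; 3]; [:: 2; 5; 0; 4; 3; 1]; [:: 3; 2; 1; 0; 5; 4];
           [:: 4; 3; 5; 1; 0; 2]; [:: 5; 4; 3; 2; 1; 0]],
       [:: [:: [:: 0]; [:: 1]; [:: 2]; [:: 3]; [:: 4]; [:: 5]];
           [:: [:: 2; 3; 4; 5]; [:: 0]; [:: 1]];
           [:: [:: 2; 4]; [:: 3; 5]; [:: 0]; [:: 1]];
           [:: [:: 1; 2; 5; 3; 4]; [:: 0]];
           [:: [:: 0; 1]; [:: 2; 3]; [:: 4; 5]];
           [:: [:: 0; 1; 2]; [:: 3; 5; 4]];
           [:: [:: 0; 1; 2; 4; 5; 3]]])]%N.

(** Properness is witnessed by one 6-cycle, 0 to 1 up to 5 and back to 0, outside the stabilizer. *)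
Definition proper_overgroup (SW : seq (seq nat) * seq (seq (seq nat))) : bool :=
  [&& all (all (gtn 6)) SW.1, ~~ preserves SW.1 (cycle_fun [:: iota 0 6])
    & all (fun ns => perm_eq (flatten ns) (iota 0 6) && preserves SW.1 (cycle_fun ns))
        SW.2].

Lemma overgroups_proper : all proper_overgroup overgroups.
Proof. by vm_compute. Qed.

Definition has_shape (W : seq (seq (seq nat))) (ks : seq nat) : bool :=
  ks \in map (map size) W.

Lemma overgroups_cover : all (fun ks => all (fun ls =>
    ~~ odd_type ks && ~~ odd_type ls ||
    has (fun SW => has_shape SW.2 ks && has_shape SW.2 ls) overgroups)
  (parts 6 6 6)) (parts 6 6 6).
Proof. by vm_compute. Qed.

Lemma stabilizer_proper S : all (all (gtn 6)) S ->
  ~~ preserves S (cycle_fun [:: iota 0 6]) -> ~~ ('Sym_('I_6) \subset stabilizer S).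
Proof.
move=> S6; apply: contra => /subsetP S_all.
have T6 : sumn [:: 6] = #|'I_6| by rewrite card_ord.
have [s s6 _] := has_type_exists T6.
have [|u suE] := @cycle_fun_conj 5 [:: iota 0 6] s _ s6; first by [].
have := S_all (s ^ u) (in_setT _); rewrite inE.
rewrite (eq_preserves (f2 := cycle_fun [:: iota 0 6])) // => i i6.
by rewrite /nat_fun suE inordK.
Qed.

Lemma mem_stabilizer S ns (s : 'S_6) : all (all (gtn 6)) S ->
    perm_eq (flatten ns) (iota 0 6) -> preserves S (cycle_fun ns) ->
    has_type (map size ns) s ->
  exists u, s ^ u \in stabilizer S.
Proof.
move=> S6 ns6 S_ns s_ns; have [u suE] := cycle_fun_conj ns6 s_ns; exists u.
rewrite inE (eq_preserves (f2 := cycle_fun ns)) // => i i6.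
by rewrite /nat_fun suE inordK.
Qed.

(** Two even elements generate a subgroup of Alt(6). Otherwise the types of [g] and [h] both occur
    in one listed overgroup, and each element is conjugated into it separately. *)
Lemma Sym6_conj_proper (g h : 'S_6) :
  exists u v, ~~ ('Sym_('I_6) \subset <<[set g ^ u; h ^ v]>>).
Proof.
have type6 (s : 'S_6) : exists2 ks, has_type ks s & ks \in parts 6 6 6.
  have [ks s_ks [ks_sorted ks_gt0 ksT]] := has_type_sorted s.
  rewrite card_ord in ksT; exists ks => //; apply: mem_parts => //.
  case: ks ks_sorted ksT {s_ks ks_gt0} => //= k ks -> ; lia.
have [ks g_ks ks6] := type6 g; have [ls h_ls ls6] := type6 h.
have T6 (s : 'S_6) ms : has_type ms s -> ms \in parts 6 6 6 -> sumn ms = #|'I_6|.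
  rewrite card_ord => _ ms6; apply/eqP.
  have : all (fun ms => sumn ms == 6) (parts 6 6 6) by vm_compute.
  by move/allP; apply.
have /orP[/andP[ks_even ls_even] |] := allP (allP overgroups_cover ks ks6) ls ls6.
  exists 1, 1; rewrite !conjg1; apply/negP=> SymH.
  have HA : <<[set g; h]>> \subset 'Alt_('I_6).
    rewrite gen_subG; apply/subsetP=> s /set2P[] ->; rewrite Alt_even.
      by rewrite (has_type_odd (T6 _ _ g_ks ks6) g_ks).
    by rewrite (has_type_odd (T6 _ _ h_ls ls6) h_ls).
  (* A transposition shows that Sym(6) is not contained in Alt(6). *)
  have := subsetP (subset_trans SymH HA) (tperm ord0 ord_max) (in_setT _).
  by rewrite Alt_even odd_tperm.
case/hasP=> -[S W] SW_in /andP[/mapP[ns nsW ks_ns] /mapP[ms msW ls_ms]] /=.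
have /and3P[S6 S_proper /allP W_ok] := allP overgroups_proper _ SW_in.
have /andP[ns6 S_ns] := W_ok _ nsW; have /andP[ms6 S_ms] := W_ok _ msW.
rewrite ks_ns in g_ks; rewrite ls_ms in h_ls.
have [u gu] := mem_stabilizer S6 ns6 S_ns g_ks.
have [v hv] := mem_stabilizer S6 ms6 S_ms h_ls.
exists u, v; apply: contra (stabilizer_proper S6 S_proper) => /subset_trans; apply.
rewrite -[stabilizer S]/(gval (Group (stabilizer_group S6))) gen_subG.
by apply/subsetP=> s /set2P[] ->.
Qed.

Lemma kappa_Sym6 : kappa 'Sym_('I_6) = 0.
Proof.
rewrite /kappa big_pred0 // => X; apply/negP=> /andP[/andP[/subsetP X_classes X_gen]].
case/card_gt1P=> C [D [CX DX CD]].
have /imsetP[g _ Cg] := X_classes C CX; have /imsetP[h _ Dh] := X_classes D DX.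
have [u [v /negP[]]] := Sym6_conj_proper g h.
have := implyP (forall_inP (forall_inP X_gen C CX) D DX) CD.
move/forall_inP/(_ (g ^ u)); rewrite Cg memJ_class ?in_setT // => /(_ isT).
move/forall_inP/(_ (h ^ v)); rewrite Dh memJ_class ?in_setT // => /(_ isT).
by move/eqP->.
Qed.

Theorem proposition6p3 (n : nat) :
  (3 <= n -> 2 <= kappa 'Alt_('I_n)%G) /\
  ((2 <= n -> n <> 6 -> 2 <= kappa 'Sym_('I_n)%G) /\
   kappa 'Sym_('I_6)%G = 0).
Proof.
split=> [n_gt2 | ].
  have [n_odd | n_even] := boolP (odd n).
    have [n_gt4 | n_le4] := ltnP 4 n; first exact: kappa_Alt_odd_ge2.
    have -> : n = 3 by lia.
    apply: kappa_prime_ge2; have := @card_Alt 'I_3; rewrite card_ord => /(_ isT).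
    by move=> A3; have -> : #|'Alt_('I_3)| = 3 by rewrite -[3`!]/(6) in A3; lia.
  have [|] := boolP (n \in [:: 0; 2; 4; 6]%N); last exact: kappa_Alt_even_ge2.
  (* Of the four exceptional even degrees only 4 and 6 are at least 3. *)
  rewrite !inE => /or4P[] /eqP n_val; rewrite n_val // in n_gt2 *.
    exact: kappa_Alt4_ge2.
  exact: kappa_Alt6_ge2.
split=> [n_gt1 n_neq6 |]; last exact: kappa_Sym6.
have [|] := boolP (n \in [:: 0; 1; 2; 3; 4; 6]%N); last exact: kappa_Sym_ge2.
rewrite !inE => /or4P[|||/or3P[]] /eqP n_val; rewrite ?n_val // in n_gt1 n_neq6 *.
- by apply: kappa_prime_ge2; rewrite card_Sym card_ord.
- exact: kappa_Sym3_ge2.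
exact: kappa_Sym4_ge2.
Qed.
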